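(* Let $\bar\zeta=h\partial_t+\zeta$ be a concurrent vector field on a doubly warped spacetime $\bar M={}_fI\times_\sigma M$ equipped with the metric tensor $\bar g=-f^2dt^2\oplus\sigma^2g$. Then $\zeta$ is a concurrent vector field on $M$ if one of the following conditions holds: (1) $h=0$, or (2) $\sigma$ is constant (i.e. $\bar M$ is a standard static spacetime). Moreover, condition (1) implies condition (2), and the converse is true if $f$ is not constant.
   Context: $(M,g)$ is a Riemannian manifold, $I$ is an open connected interval with metric $-dt^2$, and $f:M\to(0,\infty)$, $\sigma:I\to(0,\infty)$ are smooth. The doubly warped spacetime ${}_fI\times_\sigma M$ is $I\times M$ with the metric $\bar g=-f^2dt^2\oplus\sigma^2g$. Here $h:I\to\mathbb R$ is smooth and $\zeta\in\mathfrak X(M)$ (identified with its lift). A vector field $\zeta$ on a pseudo-Riemannian manifold $(N,k)$ with Levi-Civita connection $D$ is concurrent if $D_X\zeta=X$ for every $X\in\mathfrak X(N)$.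
   Formalization: M is assumed connected and non-empty (and I non-empty); for disconnected M the converse fails, e.g. M two copies of the real line, f equal to 1 and 2 on them, σ=1, h=t, ζ=x∂_x. *)

(* Defs.v *)
From HB Require Import structures.
From mathcomp Require Import all_boot all_order all_algebra.
From mathcomp Require Import boolp classical_sets functions reals.
From mathcomp Require Import topology normedtype derive.
Set Implicit Arguments.
Unset Strict Implicit.
Unset Printing Implicit Defensive.
Import Order.TTheory GRing.Theory Num.Theory.
Import numFieldNormedType.Exports.
Local Open Scope classical_set_scope.
Local Open Scope ring_scope.

(* Only meaningful for [U] open and [V] finite dimensional, where it is
   equivalent to the usual definition by iterated partial derivatives. *)
Fixpoint Ck (R : realType) (V W : normedModType R) (k : nat) (U : set V)
    (F : V -> W) : Prop :=
  (forall x, U x -> {for x, continuous F}) /\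
  (if k is k'.+1 then
     forall v, (forall x, U x -> derivable F x v) /\ Ck k' U ('D_v F)
   else True).

Definition smooth (R : realType) (V W : normedModType R) (U : set V)
  (F : V -> W) : Prop := forall k, Ck k U F.

(* [param c] is the inverse of the chart [chart_map c]; both are total functions,
   whose values outside [dom c] and [chart_map c @` dom c] are irrelevant. *)
Record atlas (R : realType) (n : nat) (T : Type) := Atlas {
  chart : Type;
  dom : chart -> set T;
  chart_map : chart -> T -> 'rV[R]_n;
  param : chart -> 'rV[R]_n -> T }.

(* The manifold is a subset [M] of the topological space [T], necessarily
   open since it is the union of the chart domains. *)
Record is_manifold (R : realType) (n : nat) (T : topologicalType)
    (A : atlas R n T) (M : set T) : Prop := {
  manifold_hausdorff : hausdorff_space T;
  manifold_second_countable : @second_countable T;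
  manifold_cover : \bigcup_(c in [set: chart A]) dom c = M;
  manifold_dom_open : forall c : chart A, open (dom c);
  manifold_image_open : forall c : chart A, open (chart_map c @` dom c);
  manifold_mapK : forall (c : chart A) p, dom c p -> param c (chart_map c p) = p;
  manifold_map_continuous : forall (c : chart A) p, dom c p ->
    {for p, continuous (chart_map c)};
  manifold_param_continuous : forall (c : chart A) x, (chart_map c @` dom c) x ->
    {for x, continuous (param c)};
  manifold_transition : forall c c' : chart A,
    smooth (chart_map c @` (dom c `&` dom c')) (chart_map c' \o param c) }.

Section OnManifold.
Variables (R : realType) (n : nat) (T : Type) (A : atlas R n T).
Implicit Types (c : chart A) (p : T).

Definition smooth_in (W : normedModType R) c (F : T -> W) : Prop :=
  smooth (chart_map c @` dom c) (F \o param c).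

Definition smooth_function (u : T -> R) : Prop :=
  forall c, smooth_in c u.

(* Derivative at [p] of [F], in the direction of the tangent vector whose
   components in the chart [c] are [v]. *)
Definition dchart (W : normedModType R) c p (v : 'rV[R]_n) (F : T -> W) : W :=
  'D_v (F \o param c) (chart_map c p).

(* A tangent vector is given by its components in each chart around its base
   point; these are related by the differential of the change of charts. *)
Definition field := chart A -> T -> 'rV[R]_n.

(* Components are 0 outside the chart domain, so that two vector fields are
   the same exactly when they are equal as terms. *)
Record vector_field (X : field) : Prop := {
  vector_field_out : forall c p, ~ dom c p -> X c p = 0;
  vector_field_change : forall c c' p, dom c p -> dom c' p ->
    X c' p = dchart c p (X c p) (chart_map c');
  vector_field_smooth : forall c, smooth_in c (X c) }.

Definition field_add (X Y : field) : field := fun c p => X c p + Y c p.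

Definition field_scale (u : T -> R) (X : field) : field := fun c p => u p *: X c p.

Definition lie_bracket (X Y : field) : field := fun c p =>
  dchart c p (X c p) (Y c) - dchart c p (Y c p) (X c).

Definition bform (m : nat) (G : 'M[R]_m) (v w : 'rV[R]_m) : R :=
  (v *m G *m w^T) 0 0.

Definition tensor := chart A -> T -> 'M[R]_n.

Record pseudo_riemannian (k : tensor) : Prop := {
  metric_sym : forall c p, dom c p -> (k c p)^T = k c p;
  metric_nondegenerate : forall c p, dom c p -> k c p \in unitmx;
  metric_change : forall c c' p v w, dom c p -> dom c' p ->
    bform (k c p) v w =
    bform (k c' p) (dchart c p v (chart_map c')) (dchart c p w (chart_map c'));
  metric_smooth : forall c, smooth_in c (k c) }.

Definition riemannian (k : tensor) : Prop :=
  pseudo_riemannian k /\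
  forall c p v, dom c p -> v != 0 -> 0 < bform (k c p) v v.

(* [D X Y] is the covariant derivative of [Y] along [X]; it is relevant on
   vector fields only. *)
Record levi_civita (k : tensor) (D : field -> field -> field) : Prop := {
  connection_field : forall X Y, vector_field X -> vector_field Y ->
    vector_field (D X Y);
  connection_addl : forall X X' Y,
    vector_field X -> vector_field X' -> vector_field Y ->
    D (field_add X X') Y = field_add (D X Y) (D X' Y);
  connection_scalel : forall u X Y, smooth_function u ->
    vector_field X -> vector_field Y ->
    D (field_scale u X) Y = field_scale u (D X Y);
  connection_addr : forall X Y Y',
    vector_field X -> vector_field Y -> vector_field Y' ->
    D X (field_add Y Y') = field_add (D X Y) (D X Y');
  connection_leibniz : forall u X Y, smooth_function u ->
    vector_field X -> vector_field Y ->
    forall c p, dom c p ->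
    D X (field_scale u Y) c p = dchart c p (X c p) u *: Y c p + u p *: D X Y c p;
  connection_torsion_free : forall X Y, vector_field X -> vector_field Y ->
    forall c p, dom c p -> D X Y c p - D Y X c p = lie_bracket X Y c p;
  connection_metric : forall X Y Z,
    vector_field X -> vector_field Y -> vector_field Z ->
    forall c p, dom c p ->
    dchart c p (X c p) (fun q => bform (k c q) (Y c q) (Z c q)) =
    bform (k c p) (D X Y c p) (Z c p) + bform (k c p) (Y c p) (D X Z c p) }.

Definition concurrent (D : field -> field -> field) (Z : field) : Prop :=
  vector_field Z /\ forall X, vector_field X -> D X Z = X.

End OnManifold.

Section Warped.
Variables (R : realType) (n : nat) (T : Type) (I : set R) (A : atlas R n T).

(* The product charts of the manifold [I `*` M]; coordinate 0 is time. *)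
Definition spacetime_atlas : atlas R (1 + n) (R * T) :=
  @Atlas R (1 + n) (R * T) (chart A)
    (fun c => I `*` dom c)
    (fun c x => row_mx x.1%:M (chart_map c x.2))
    (fun c s => (lsubmx s 0 0, param c (rsubmx s))).

Definition warped_metric (f : T -> R) (sigma : R -> R) (g : tensor A) :
    tensor spacetime_atlas := fun c x =>
  block_mx (- (f x.2 ^+ 2))%:M 0 0 (sigma x.1 ^+ 2 *: g c x.2).

(* The vector field [h d/dt + zeta]. *)
Definition spacetime_field (h : R -> R) (zeta : field A) :
    field spacetime_atlas := fun c =>
  patch (fun=> 0) (dom c) (fun x => row_mx (h x.1)%:M (zeta c x.2)).

End Warped.
Arguments warped_metric {R n T} I {A}.
Arguments spacetime_field {R n T} I {A}.

(* Main.v *)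
(* The Koszul formula expresses the covariant derivative of h d/dt + zeta
   along a d/dt + X, paired with b d/dt + Y, through f, sigma, h and the
   covariant derivative of zeta on M.  For (a, b) = (0, 0) it says that zeta is
   concurrent up to the factor 1 - h sigma'/sigma; for (1, 1) with X = Y = 0
   it says zeta(f) = (1 - h') f; and for (1, 0) with X = 0 it says
   sigma sigma' g(zeta, Y) + f h Y(f) = 0.  If h = 0 and sigma' is nonzero
   somewhere, Y = zeta in the last identity gives zeta = 0, against zeta(f) = f.
   If sigma is constant and h is nonzero somewhere, Y = grad f gives df = 0,
   so f is constant since M is connected.  The gradient is used because only
   global vector fields may be substituted. *)

Require Import Defs.
From HB Require Import structures.
From mathcomp Require Import all_boot all_order all_algebra.
From mathcomp Require Import boolp classical_sets functions reals.
From mathcomp Require Import topology normedtype derive.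
From mathcomp Require Import ring.
Set Implicit Arguments.
Unset Strict Implicit.
Unset Printing Implicit Defensive.
Import Order.TTheory GRing.Theory Num.Theory.
Import numFieldNormedType.Exports.
Local Open Scope classical_set_scope.
Local Open Scope ring_scope.

(** * Calculus of smooth maps *)

Section Smoothness.
Variable R : realType.
Implicit Types V W : normedModType R.

(** Since [U] is open, agreement on [U] is agreement near each of its points, so limits and
    directional derivatives of all orders carry over. *)
Lemma Ck_ext V W k (U : set V) (F G : V -> W) :
  open U -> (forall x, U x -> F x = G x) -> Ck k U F -> Ck k U G.
Proof.
move=> oU; elim: k F G => [|k IH] F G FG [cF dF].
  split=> // x Ux; rewrite /prop_for /continuous_at -FG//.
  apply: cvg_trans (cF _ Ux); apply: near_eq_cvg.
  by near=> y; apply: FG; near: y; exact: open_nbhs_nbhs.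
have nFG x : U x -> \near x, F x = G x.
  by move=> Ux; near=> y; apply: FG; near: y; exact: open_nbhs_nbhs.
split=> [x Ux|v].
  by rewrite /prop_for /continuous_at -FG//; apply: cvg_trans (cF _ Ux);
    apply: near_eq_cvg; exact: nFG.
have [derF CF] := dF v; split=> [x Ux|].
  by apply: near_eq_derivable (derF _ Ux); exact: nFG.
by apply: IH CF => x Ux; apply: near_eq_derive; exact: nFG.
Unshelve. all: by end_near. Qed.

Lemma CkS V W k (U : set V) (F : V -> W) : Ck k.+1 U F -> Ck k U F.
Proof.
elim: k F => [|k IH] F [cF dF]; split=> // v.
by have [? CF] := dF v; split=> //; exact: IH.
Qed.

Lemma Ck_sub V W k (U U' : set V) (F : V -> W) :
  U' `<=` U -> Ck k U F -> Ck k U' F.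
Proof.
move=> UU; elim: k F => [|k IH] F [cF dF]; split=> //; try by move=> x /UU/cF.
move=> v; have [dv Cv] := dF v.
by split; [move=> x /UU/dv | exact: IH].
Qed.

Lemma Ck_cst V W k (U : set V) (w : W) : Ck k U (cst w).
Proof.
elim: k w => [|k IH] w; split=> //; try by move=> x _; exact: cst_continuous.
move=> v; split=> [x _|]; first exact: derivable_cst.
have -> : 'D_v (cst w : V -> W) = cst 0.
  by apply/funext => x; rewrite derive_cst.
exact: IH.
Qed.

Lemma CkD V W k (U : set V) (F G : V -> W) :
  open U -> Ck k U F -> Ck k U G -> Ck k U (F + G).
Proof.
move=> oU; elim: k F G => [|k IH] F G [cF dF] [cG dG]; split=> //;
  try by move=> x Ux; apply: continuousD; [exact: cF|exact: cG].
move=> v; have [dFv CFv] := dF v; have [dGv CGv] := dG v.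
split=> [x Ux|]; first by apply: derivableD; [exact: dFv|exact: dGv].
apply: Ck_ext (IH _ _ CFv CGv) => // x Ux.
by rewrite deriveD; [|exact: dFv|exact: dGv].
Qed.

(** By the Leibniz rule the derivative is again a sum of products; [CkS] lowers the order of the
    undifferentiated factors to match. *)
Lemma CkM V k (U : set V) (F G : V -> R) :
  open U -> Ck k U F -> Ck k U G -> Ck k U (F * G).
Proof.
move=> oU; elim: k F G => [|k IH] F G CF CG.
  by split=> // x Ux; apply: continuousM; [exact: CF.1|exact: CG.1].
have [cF dF] := CF; have [cG dG] := CG; split=> [x Ux|v].
  by apply: continuousM; [exact: cF|exact: cG].
have [dFv CFv] := dF v; have [dGv CGv] := dG v.
split=> [x Ux|]; first by apply: derivableM; [exact: dFv|exact: dGv].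
apply: (@Ck_ext _ _ _ _ (F * 'D_v G + G * 'D_v F)) => // [x Ux|].
  by rewrite deriveM; [|exact: dFv|exact: dGv].
by apply: CkD => //; apply: IH => //; apply: CkS.
Qed.

(** The derivative of [1/F] is [-F^-2] times that of [F], so the induction hypothesis is applied to
    [1/F] itself, one order lower. *)
Lemma CkV V k (U : set V) (F : V -> R) : open U ->
  (forall x, U x -> F x != 0) -> Ck k U F -> Ck k U (fun x => (F x)^-1).
Proof.
move=> oU F0; elim: k => [|k IH] CF.
  by split=> // x Ux; apply: continuousV; [exact: F0|exact: CF.1].
have [cF dF] := CF; split=> [x Ux|v].
  by apply: continuousV; [exact: F0|exact: cF].
have [dFv CFv] := dF v.
split=> [x Ux|]; first by apply: derivableV; [exact: F0|exact: dFv].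
have CI := IH (CkS CF).
apply: (@Ck_ext _ _ _ _ (cst (-1) * ((fun x => (F x)^-1) * (fun x => (F x)^-1))
    * 'D_v F)) => // [x Ux|].
  rewrite deriveV; [|exact: F0|exact: dFv].
  by rewrite -[LHS]/(_ * (_ * _) * _) mulN1r -exprVn expr2.
by apply: (CkM oU) => //; apply: (CkM oU); [exact: Ck_cst|exact: CkM].
Qed.

Lemma Ck_sum V k (U : set V) (J : Type) (r : seq J) (F : J -> V -> R) :
  open U -> (forall i, Ck k U (F i)) ->
  Ck k U (fun x => \sum_(i <- r) F i x : R).
Proof.
move=> oU CF; elim: r => [|i r IH].
  apply: (@Ck_ext V R k U (cst 0)) => // [x _|]; last exact: Ck_cst.
  by rewrite big_nil.
by apply: Ck_ext (CkD oU (CF i) IH) => // x _; rewrite big_cons.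
Qed.

Lemma Ck_prod V k (U : set V) (J : Type) (r : seq J) (F : J -> V -> R) :
  open U -> (forall i, Ck k U (F i)) ->
  Ck k U (fun x => \prod_(i <- r) F i x : R).
Proof.
move=> oU CF; elim: r => [|i r IH].
  apply: (@Ck_ext V R k U (cst 1)) => // [x _|]; last exact: Ck_cst.
  by rewrite big_nil.
by apply: Ck_ext (CkM oU (CF i) IH) => // x _; rewrite big_cons.
Qed.

(** The norm is the maximum of finitely many entries, so the entrywise estimates hold simultaneously
    near [x]. *)
Lemma continuous_mxP V m n (F : V -> 'M[R]_(m, n)) x :
  {for x, continuous F} <-> forall i j, {for x, continuous (fun y => F y i j)}.
Proof.
split=> [cF i j|cF].
  apply: (@continuous_comp _ _ _ F (fun M : 'M[R]_(m, n) => M i j)) => //.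
  exact: coord_continuous.
apply/cvgrPdist_le => /= e e0; near=> y.
rewrite /Num.Def.normr/= mx_normrE (bigmax_le _ (ltW e0))//= => -[i j] _.
rewrite !mxE/=; move: i j; near: y; apply: filter_forall => i.
apply: filter_forall => j.
exact: ((cvgrPdist_le _ _).1 (cF i j)).
Unshelve. all: by end_near. Qed.

Lemma Ck_mxP V m n k (U : set V) (F : V -> 'M[R]_(m, n)) : open U ->
  Ck k U F <-> forall i j, Ck k U (fun x => F x i j).
Proof.
move=> oU; elim: k F => [|k IH] F.
  split=> [[cF _] i j|CF]; split=> // x Ux.
      exact: (continuous_mxP _ _).1 (cF x Ux) i j.
  by apply/continuous_mxP => i j; apply: (CF i j).1.
split=> [[cF dF] i j|CF]; split=> [x Ux|v].
- exact: (continuous_mxP _ _).1 (cF x Ux) i j.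
- have [dFv CFv] := dF v; split=> [x Ux|].
    exact: (derivable_mxP _ _ _).1 (dFv x Ux) i j.
  apply: Ck_ext ((IH _).1 CFv i j) => // x Ux.
  by rewrite derive_mx ?mxE//; exact: dFv.
- by apply/continuous_mxP => i j; apply: (CF i j).1.
- have dFv x : U x -> derivable F x v.
    by move=> Ux; apply/derivable_mxP => i j; apply: ((CF i j).2 v).1.
  split=> //; apply/IH => i j.
  apply: Ck_ext ((CF i j).2 v).2 => // x Ux.
  by rewrite derive_mx ?mxE//; exact: dFv.
Qed.

Lemma Ck_mulmx V m n p k (U : set V) (F : V -> 'M[R]_(m, n))
    (G : V -> 'M[R]_(n, p)) :
  open U -> Ck k U F -> Ck k U G -> Ck k U (fun x => F x *m G x).
Proof.
move=> oU /(Ck_mxP _ _ oU) CF /(Ck_mxP _ _ oU) CG; apply/Ck_mxP => // i j.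
have C := Ck_sum (index_enum 'I_n) oU (fun l => CkM oU (CF i l) (CG l j)).
by apply: Ck_ext C => // x Ux; rewrite mxE.
Qed.

Lemma Ck_trmx V m n k (U : set V) (F : V -> 'M[R]_(m, n)) :
  open U -> Ck k U F -> Ck k U (fun x => (F x)^T).
Proof.
move=> oU /(Ck_mxP _ _ oU) CF; apply/Ck_mxP => // i j.
by apply: Ck_ext (CF j i) => // x Ux; rewrite mxE.
Qed.

Lemma Ck_det V n k (U : set V) (F : V -> 'M[R]_n) :
  open U -> Ck k U F -> Ck k U (fun x => \det (F x) : R).
Proof.
move=> oU /(Ck_mxP _ _ oU) CF; rewrite /determinant.
apply: Ck_sum => // s; apply: (@CkM _ _ _ (cst _)) => //.
  exact: (@Ck_cst V R).
exact: Ck_prod.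
Qed.

(** By Cramer's rule each entry is a cofactor divided by the determinant, hence built from sums,
    products and one inverse. This gives the smoothness of the inverse metric. *)
Lemma Ck_invmx V n k (U : set V) (F : V -> 'M[R]_n) : open U ->
  (forall x, U x -> F x \in unitmx) ->
  Ck k U F -> Ck k U (fun x => invmx (F x)).
Proof.
move=> oU uF CF; apply/Ck_mxP => // i j.
have CV : Ck k U (fun x => (\det (F x))^-1).
  apply: CkV => //; last exact: Ck_det.
  by move=> x /uF; rewrite unitmxE unitfE.
have CA : Ck k U (fun x => cofactor (F x) j i).
  apply: (@CkM _ _ _ (cst _)) => //; first exact: (@Ck_cst V R).
  apply: Ck_det => //; apply/Ck_mxP => // a b.
  move/(Ck_mxP _ _ oU): CF => CF.
  by apply: Ck_ext (CF (lift j a) (lift i b)) => // x _; rewrite !mxE.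
apply: Ck_ext (CkM oU CV CA) => // x Ux.
by rewrite /invmx uF// !mxE.
Qed.

(** The two difference quotients are literally the same function, as [L (h v + x) = h L v + L x]. *)
Lemma derive_comp_linear V V' W (L : V -> V') (F : V' -> W) x v :
  linear L -> 'D_v (F \o L) x = 'D_(L v) F (L x).
Proof.
move=> lL; rewrite /derive.
set G := fun h => _; set H := fun h => _.
by have -> : G = H by apply/funext => h; rewrite /G /H /= lL.
Qed.

Lemma derivable_comp_linear V V' W (L : V -> V') (F : V' -> W) x v :
  linear L -> derivable F (L x) (L v) -> derivable (F \o L) x v.
Proof.
move=> lL; rewrite /derivable.
set G := fun h => _; set H := fun h => _.
by have -> : G = H by apply/funext => h; rewrite /G /H /= lL.
Qed.

(** Differentiating along [v] gives ['D_(L v) F] composed with [L], so the induction keeps its form.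
    It serves for the two projections of a product chart. *)
Lemma Ck_comp_linear V V' W k (U : set V') (L : V -> V') (F : V' -> W) :
  linear L -> continuous L -> Ck k U F -> Ck k (L @^-1` U) (F \o L).
Proof.
move=> lL cL; elim: k F => [|k IH] F [cF dF]; split=> //;
  try by move=> x Ux; apply: continuous_comp; [exact: cL|exact: cF].
move=> v; have [dFv CFv] := dF (L v); split=> [x Ux|].
  by apply: derivable_comp_linear => //; exact: dFv.
have -> : 'D_v (F \o L) = 'D_(L v) F \o L.
  by apply/funext => x; rewrite derive_comp_linear.
exact: IH.
Qed.

End Smoothness.

(** * Mean value theorem and chain rule for directional derivatives *)

Section ChainRule.
Variable R : realType.
Implicit Types V W : normedModType R.

Lemma is_derive_line V W (F : V -> W) (x v : V) (s : R) :
  derivable F (s *: v + x) v ->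
  is_derive s 1 (fun r : R => F (r *: v + x)) ('D_v F (s *: v + x)).
Proof.
have E : (fun h : R => h^-1 *: ((fun r : R => F (r *: v + x)) (h *: 1 + s)
             - F (s *: v + x))) =
         (fun h : R => h^-1 *: ((F \o shift (s *: v + x)) (h *: v)
             - F (s *: v + x))).
  by apply/funext => h /=; rewrite [h *: 1]mulr1 scalerDl addrA.
by move=> dF; split; [rewrite /derivable /= E|rewrite /derive /= E].
Qed.

(** Restricting [F] to the line through [x] along [v] gives a function of one real variable, whose
    differential at 0 is linear. *)
Lemma is_derive_scaledir V W (F : V -> W) (x v : V) (a : R) :
  derivable F x v -> is_derive x (a *: v) F (a *: 'D_v F x).
Proof.
move=> dF; pose g r := F (r *: v + x).
have [dg Dg] : is_derive (0 : R) 1 g ('D_v F x).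
  by have := @is_derive_line _ _ F x v 0; rewrite scale0r add0r; exact.
have diffg : differentiable g 0 by apply/derivable1_diffP.
have E : (fun h : R => h^-1 *: ((g \o shift 0) (h *: a) - g 0)) =
         (fun h : R => h^-1 *: ((F \o shift x) (h *: (a *: v)) - F x)).
  by apply/funext => h /=; rewrite /g !addr0 scalerA scale0r add0r.
split.
  by rewrite /derivable -E; exact: diff_derivable.
rewrite /derive -E -[LHS]/('D_a g 0) deriveE// -[in LHS](mulr1 a).
by rewrite [LHS]linearZ -deriveE// Dg.
Qed.

Lemma derive_mvt V (F : V -> R) (x v : V) :
  (forall s : R, 0 <= s <= 1 -> derivable F (s *: v + x) v) ->
  exists2 s : R, 0 <= s <= 1 & F (v + x) - F x = 'D_v F (s *: v + x).
Proof.
move=> dF.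
have dg (s : R) : s \in `[0, 1] ->
    is_derive s 1 (fun r : R => F (r *: v + x)) ('D_v F (s *: v + x)).
  by move=> s01; apply: is_derive_line; apply: dF; rewrite in_itv in s01.
have cg : {within `[(0 : R), 1], continuous (fun r : R => F (r *: v + x))}.
  by apply: derivable_within_continuous => s /dg [].
have dg' (s : R) : s \in `](0 : R), 1[ ->
    is_derive s 1 (fun r : R => F (r *: v + x)) ('D_v F (s *: v + x)).
  by move=> /subset_itv_oo_cc; exact: dg.
have [s s01] := MVT_segment ler01 dg' cg.
rewrite scale1r scale0r add0r subr0 mulr1 => ->.
by exists s => //; rewrite in_itv in s01.
Qed.

(** As [k] runs from 0 to [n], these are the vertices of an axis-parallel path from 0 to [v]. *)
Definition trunc_row n (v : 'rV[R]_n) (k : nat) : 'rV[R]_n :=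
  \row_j (if (j < k)%N then v 0 j else 0).

Lemma normr_row_le n (v w : 'rV[R]_n) :
  (forall j, `|v 0 j| <= `|w 0 j|) -> `|v| <= `|w|.
Proof.
move=> vw; rewrite {1}/Num.Def.normr/= mx_normrE.
apply: bigmax_le => [|[i j] _ /=]; first exact: normr_ge0.
apply: le_trans (_ : `|w 0 j| <= _); first by rewrite (ord1 i).
rewrite [leRHS]/Num.Def.normr/= mx_normrE.
exact: (le_bigmax _ (fun i => `|w i.1 i.2|) (0, j)).
Qed.

(* Telescoping along the coordinate directions, with the mean value theorem
   on each segment. *)
Lemma increment_partials n (F : 'rV[R]_n -> R) (x v : 'rV[R]_n) :
  (forall w i, `|w| <= `|v| -> derivable F (w + x) (delta_mx 0 i)) ->
  exists xi : 'I_n -> 'rV[R]_n, (forall i, `|xi i| <= `|v|) /\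
    F (v + x) - F x = \sum_i v 0 i * 'D_(delta_mx 0 i) F (xi i + x).
Proof.
move=> dF.
have step (i : 'I_n) : exists w : 'rV[R]_n, `|w| <= `|v| /\
    F (trunc_row v i.+1 + x) - F (trunc_row v i + x) =
    v 0 i * 'D_(delta_mx 0 i) F (w + x).
  (* On the edge number [i], the coordinates before [i] are those of [v], the one at [i] is [s]
     times that of [v], and the later ones are 0; the sup norm is thus at most that of [v]. *)
  have nw (s : R) : 0 <= s <= 1 ->
      `|s *: (v 0 i *: delta_mx 0 i) + trunc_row v i| <= `|v|.
    move=> /andP[s0 s1]; apply: normr_row_le => j; rewrite !mxE eqxx /=.
    case: (eqVneq j i) => [->|ji]; last first.
      rewrite mulr0 mulr0 add0r; case: ifP => _ //.
      by rewrite normr0.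
    by rewrite ltnn addr0 mulr1 normrM ger0_norm// ler_piMl.
  have [|s s01] := @derive_mvt _ F (trunc_row v i + x) (v 0 i *: delta_mx 0 i).
    move=> s s01; rewrite addrA.
    by have [] := is_derive_scaledir (v 0 i) (dF _ i (nw s s01)).
  have -> : v 0 i *: delta_mx 0 i + (trunc_row v i + x) = trunc_row v i.+1 + x.
    rewrite addrA; congr (_ + x); apply/rowP => j; rewrite !mxE eqxx /= ltnS.
    case: (eqVneq j i) => [->|ji]; first by rewrite ltnn leqnn mulr1 addr0.
    have /negbTE nji : (j : nat) != i by [].
    by rewrite mulr0 add0r (leq_eqVlt j) nji.
  rewrite addrA => ->.
  have [_ ->] := is_derive_scaledir (v 0 i) (dF _ i (nw s s01)).
  by exists (s *: (v 0 i *: delta_mx 0 i) + trunc_row v i); split; first exact: nw.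
have [xi xiP] := choice step; exists xi; split=> [i|]; first by have [] := xiP i.
transitivity (\sum_(i < n) (F (trunc_row v i.+1 + x) - F (trunc_row v i + x))).
  rewrite -(big_mkord xpredT (fun i => F (trunc_row v i.+1 + x) -
    F (trunc_row v i + x))) telescope_sumr//; congr (F _ - F _).
    by congr (_ + x); apply/rowP => j; rewrite mxE ltn_ord.
  by rewrite -[LHS]add0r; congr (_ + x); apply/rowP => j; rewrite !mxE ltn0.
by apply: eq_bigr => i _; have [] := xiP i.
Qed.

(** The increment of [F] along [phi] is a sum of coordinate increments times partial derivatives at
    intermediate points. These points tend to [phi x], where the partial derivatives are continuous,
    so the difference quotient converges term by term. *)
Lemma chain_rule V n (U : set 'rV[R]_n) (F : 'rV[R]_n -> R)
    (phi : V -> 'rV[R]_n) (x w : V) : open U -> Ck 1 U F -> U (phi x) -> derivable phi x w ->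
  is_derive x w (F \o phi)
    (\sum_i ('D_w phi x) 0 i * 'D_(delta_mx 0 i) F (phi x)).
Proof.
move=> oU [cF dF] Ux dphi.
have /nbhs_ballP[e /= e0 beU] : nbhs (phi x) U by exact: open_nbhs_nbhs.
pose inc (h : R) := phi (h *: w + x) - phi x.
have inc0 : inc h @[h --> 0^'] --> (0 : 'rV[R]_n).
  have : {for (0 : R), continuous (fun h : R => phi (h *: w + x))}.
    apply: differentiable_continuous; apply/derivable1_diffP.
    exact: (derivable1P _ _ _).1.
  move=> /continuous_withinNx; rewrite scale0r add0r => c.
  rewrite -[X in _ --> X](subrr (phi x)).
  by apply: cvgB => //; exact: cvg_cst.
(* The bound [e] keeps the intermediate points inside [U]; for an [h] with a larger increment, 0 is
   a mere placeholder. *)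
have /choice[xi xiP] (h : R) : exists xi : 'I_n -> 'rV[R]_n,
    `|inc h| < e -> (forall i, `|xi i| <= `|inc h|) /\
    F (inc h + phi x) - F (phi x) =
      \sum_i inc h 0 i * 'D_(delta_mx 0 i) F (xi i + phi x).
  have [lte|ge] := ltP `|inc h| e; last by exists (fun=> 0).
  have [|xi [xi1 xi2]] := @increment_partials n F (phi x) (inc h).
    move=> v i le_v; apply: (dF _).1; apply: beU.
    by rewrite -ball_normE /= opprD addrCA subrr addr0 normrN (le_lt_trans le_v).
  by exists xi.
have xi0 i : xi h i @[h --> 0^'] --> (0 : 'rV[R]_n).
  apply/cvgr0Pnorm_lt => d d0; near=> h.
  (* The bound [d] is the one required by the limit, and [e] makes [xiP] available. *)
  have hd : `|inc h| < Num.min d e.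
    by near: h; apply: (cvgr0_norm_lt _ inc0); rewrite lt_min d0.
  move: hd; rewrite lt_min => /andP[hd he].
  by apply: le_lt_trans hd; apply: (xiP h he).1.
have cvgq : h^-1 *: ((F \o phi \o shift x) (h *: w) - (F \o phi) x)
    @[h --> 0^'] --> \sum_i ('D_w phi x) 0 i * 'D_(delta_mx 0 i) F (phi x).
  apply: (@cvg_trans _ ((\sum_i (h^-1 *: inc h) 0 i *
      'D_(delta_mx 0 i) F (xi h i + phi x)) @[h --> 0^'])).
    apply: near_eq_cvg; near=> h.
    have he : `|inc h| < e by near: h; apply: (cvgr0_norm_lt _ inc0).
    have := (xiP h he).2; rewrite {1}/inc subrK /= => ->.
    rewrite [RHS]mulr_sumr; apply: eq_bigr => i _.
    by rewrite mxE mulrA.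
  apply: cvg_big => // [|i _]; first exact: add_continuous.
  apply: cvgM.
    apply: (@cvg_comp _ _ _ (fun h => h^-1 *: inc h) (fun M : 'rV[R]_n => M 0 i)
      _ (nbhs ('D_w phi x))); first exact: dphi.
    exact: coord_continuous.
  apply: (@cvg_comp _ _ _ (fun h => xi h i + phi x) ('D_(delta_mx 0 i) F)
      _ (nbhs (phi x))).
    have : xi h i + phi x @[h --> 0^'] --> 0 + phi x.
      by apply: cvgD; [exact: xi0|exact: cvg_cst].
    by rewrite add0r.
  exact: (dF _).2.1.
split; [by apply/cvg_ex; eexists; exact: cvgq|exact: cvg_lim cvgq].
Unshelve. all: by end_near. Qed.

End ChainRule.

(** * The Koszul formula *)

Section BilinearForm.
Variables (R : realType) (m : nat).
Implicit Types (G : 'M[R]_m) (u v w : 'rV[R]_m).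

Lemma bformDl G u v w : bform G (u + v) w = bform G u w + bform G v w.
Proof. by rewrite /bform !mulmxDl mxE. Qed.

Lemma bformNl G u w : bform G (- u) w = - bform G u w.
Proof. by rewrite /bform !mulNmx mxE. Qed.

Lemma bform0l G w : bform G 0 w = 0.
Proof. by rewrite /bform !mul0mx mxE. Qed.

Lemma bformC G u v : G^T = G -> bform G u v = bform G v u.
Proof.
move=> sG; rewrite /bform; have -> : v *m G *m u^T = (u *m G *m v^T)^T.
  by rewrite !trmx_mul trmxK sG mulmxA.
by rewrite [RHS]mxE.
Qed.

Lemma bformDr G u v w : bform G u (v + w) = bform G u v + bform G u w.
Proof. by rewrite /bform linearD mulmxDr mxE. Qed.

Lemma bformNr G u w : bform G u (- w) = - bform G u w.
Proof. by rewrite /bform linearN mulmxN mxE. Qed.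

Lemma bform0r G u : bform G u 0 = 0.
Proof. by rewrite /bform trmx0 mulmx0 mxE. Qed.

(** Testing against the standard basis shows that [u *m G] vanishes, and [G] is invertible. *)
Lemma bform_nondegenerate G u :
  G \in unitmx -> (forall w, bform G u w = 0) -> u = 0.
Proof.
move=> uG u0; have uG0 : u *m G = 0.
  apply/rowP => j; have := u0 (delta_mx 0 j).
  by rewrite /bform trmx_delta -colE !mxE.
by rewrite -(mulmxK uG u) uG0 mul0mx.
Qed.

End BilinearForm.

Section Koszul.
Variables (R : realType) (n : nat) (T : Type) (A : atlas R n T).

(** Metric compatibility expands the three derivatives and vanishing torsion expands the brackets;
    by symmetry all but one pair of terms cancels. Symmetry is a separate hypothesis, so that the
    formula serves both [g] and the warped metric. *)
Lemma koszul (k : tensor A) (D : field A -> field A -> field A)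
    (X Z Y : field A) c p :
  (forall c p, dom c p -> (k c p)^T = k c p) ->
  levi_civita k D -> vector_field X -> vector_field Z -> vector_field Y ->
  dom c p ->
  2 * bform (k c p) (D X Z c p) (Y c p) =
    dchart c p (X c p) (fun q => bform (k c q) (Z c q) (Y c q)) +
    dchart c p (Z c p) (fun q => bform (k c q) (X c q) (Y c q)) -
    dchart c p (Y c p) (fun q => bform (k c q) (X c q) (Z c q)) +
    bform (k c p) (lie_bracket X Z c p) (Y c p) -
    bform (k c p) (Z c p) (lie_bracket X Y c p) -
    bform (k c p) (X c p) (lie_bracket Z Y c p).
Proof.
move=> sk [_ _ _ _ _ tf met] vX vZ vY dp.
rewrite !met// -!tf// !(bformDl, bformDr, bformNl, bformNr).
rewrite (bformC (D Y X c p) (Z c p) (sk c p dp)).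
by ring.
Qed.

End Koszul.

(** * Derivatives of matrix-valued maps *)

Section MatrixDerive.
Variables (R : realType) (V : normedModType R).

Lemma is_derive_mx m n (F : V -> 'M[R]_(m, n)) (dF : 'M[R]_(m, n)) x v :
  (forall i j, is_derive x v (fun y => F y i j) (dF i j)) -> is_derive x v F dF.
Proof.
move=> dFij; have derF : derivable F x v.
  by apply/derivable_mxP => i j; have [] := dFij i j.
split=> //; rewrite derive_mx//; apply/matrixP => i j.
by rewrite mxE; have [_ ->] := dFij i j.
Qed.

Lemma is_derive_row_mx m n1 n2 (F : V -> 'M[R]_(m, n1)) (G : V -> 'M[R]_(m, n2))
    dF dG x v :
  is_derive x v F dF -> is_derive x v G dG ->
  is_derive x v (fun y => row_mx (F y) (G y)) (row_mx dF dG).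
Proof.
move=> [derF DF] [derG DG]; apply: is_derive_mx => i j.
case: (split_ordP j) => l ->; rewrite ?row_mxEl ?row_mxEr.
  rewrite (_ : (fun _ => _) = (fun y => F y i l)).
    split; first exact: (derivable_mxP _ _ _).1.
    by rewrite -DF derive_mx// mxE.
  by apply/funext => y; rewrite row_mxEl.
rewrite (_ : (fun _ => _) = (fun y => G y i l)).
  split; first exact: (derivable_mxP _ _ _).1.
  by rewrite -DG derive_mx// mxE.
by apply/funext => y; rewrite row_mxEr.
Qed.

Lemma is_derive_scalar1 (F : V -> R) dF x v :
  is_derive x v F dF -> is_derive x v (fun y => (F y)%:M : 'M[R]_1) dF%:M.
Proof.
move=> dFx; apply: is_derive_mx => i j.
rewrite (_ : (fun _ => _) = F); first by rewrite mxE !ord1.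
by apply/funext => y; rewrite mxE !ord1.
Qed.

End MatrixDerive.

(** * Calculus in charts and the gradient field *)

Section DirectionalChainRule.
Variables (R : realType) (V : normedModType R) (n : nat) (U : set 'rV[R]_n).
Variables (phi : V -> 'rV[R]_n) (x w : V).
Hypotheses (oU : open U) (Ux : U (phi x)) (dphi : derivable phi x w).

(** The sum over partial derivatives is recognized as one directional derivative by applying
    [chain_rule] a second time, to the identity. *)
Lemma is_derive_comp (F : 'rV[R]_n -> R) : Ck 1 U F ->
  is_derive x w (F \o phi) ('D_('D_w phi x) F (phi x)).
Proof.
move=> CF; have [d1 D1] := chain_rule oU CF Ux dphi; split=> //; rewrite D1.
have [_ D2] := @chain_rule R _ n U F id (phi x) ('D_w phi x) oU CF Ux
  (@derivable_id _ _ _ _).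
by rewrite -[F]/(F \o id) D2 derive_id.
Qed.

Lemma is_derive_comp_mx m p (F : 'rV[R]_n -> 'M[R]_(m, p)) : Ck 1 U F ->
  is_derive x w (F \o phi) ('D_('D_w phi x) F (phi x)).
Proof.
move=> CF; apply: is_derive_mx => i j.
rewrite derive_mx; last exact: (CF.2 _).1.
by rewrite mxE; apply: is_derive_comp; exact: ((Ck_mxP _ _ oU).1 CF).
Qed.

End DirectionalChainRule.

Section ManifoldCalculus.
Variables (R : realType) (n : nat) (T : topologicalType) (A : atlas R n T).
Hypothesis hM : is_manifold A [set: T].
Implicit Types (c : chart A) (p : T) (v : 'rV[R]_n).

Lemma near_param c (B : set T) p : open B -> dom c p -> B p ->
  \forall y \near chart_map c p, B (param c y).
Proof.
move=> oB dp Bp; have Up : (chart_map c @` dom c) (chart_map c p) by exists p.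
apply: (manifold_param_continuous hM Up).
by rewrite (manifold_mapK hM dp); exact: open_nbhs_nbhs.
Qed.

Lemma image_param c x : (chart_map c @` dom c) x ->
  dom c (param c x) /\ chart_map c (param c x) = x.
Proof. by case=> p dp <-; rewrite (manifold_mapK hM dp). Qed.

(** Within the open chart image, this set is the preimage of [B] under the continuous map [param c].
    It is used for overlaps of charts. *)
Lemma open_image c (B : set T) : open B -> open (chart_map c @` (dom c `&` B)).
Proof.
move=> oB; rewrite openE => _ [p [dp Bp] <-]; rewrite /interior.
have nU : nbhs (chart_map c p) (chart_map c @` dom c).
  by apply: open_nbhs_nbhs; split; [exact: manifold_image_open hM _|exists p].
near=> y; have : (chart_map c @` dom c) y by near: y.
move=> /image_param[dy yE]; exists (param c y) => //; split=> //.
by near: y; exact: near_param.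
Unshelve. all: by end_near. Qed.

Lemma derivable_smooth_in (W : normedModType R) c p v (F : T -> W) :
  smooth_in c F -> dom c p -> derivable (F \o param c) (chart_map c p) v.
Proof. by move=> sF dp; apply: ((sF 1%N).2 v).1; exists p. Qed.

Lemma derivable_transition c c' p v : dom c p -> dom c' p ->
  derivable (chart_map c' \o param c) (chart_map c p) v.
Proof.
by move=> dp dp'; apply: ((manifold_transition hM c c' 1).2 v).1; exists p.
Qed.

(** Near the point, [u] read in [c] is [u] read in [c'] composed with the transition map, so the
    chain rule applies. *)
Lemma dchart_change (u : T -> R) c c' p v : smooth_in c' u ->
  dom c p -> dom c' p ->
  dchart c p v u = dchart c' p (dchart c p v (chart_map c')) u.
Proof.
move=> su dp dp'; have oU : open (chart_map c' @` dom c').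
  exact: manifold_image_open hM _.
have := @is_derive_comp R _ n _ (chart_map c' \o param c) (chart_map c p) v oU _
  (derivable_transition dp dp') _ (su 1%N).
rewrite /= (manifold_mapK hM dp) => -[|_]; first by exists p.
rewrite /dchart => <-.
apply: near_eq_derive; near=> y => /=; rewrite (manifold_mapK hM)//.
by near: y; apply: near_param => //; exact: manifold_dom_open hM _.
Unshelve. all: by end_near. Qed.

(** The two transition maps compose to the identity near the point, so their differentials are
    mutually inverse. *)
Lemma dchart_transitionK c c' p v : dom c p -> dom c' p ->
  dchart c p (dchart c' p v (chart_map c)) (chart_map c') = v.
Proof.
move=> dp dp'; have oU : open (chart_map c @` (dom c `&` dom c')).
  by apply: open_image; exact: manifold_dom_open hM _.
have := @is_derive_comp_mx R _ n _ (chart_map c \o param c') (chart_map c' p) v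
  oU _ (derivable_transition dp' dp) _ _ _ (manifold_transition hM c c' 1).
rewrite /= (manifold_mapK hM dp') => -[|_ D]; first by exists p.
rewrite {1}/dchart /= in D *; rewrite -D -[RHS](derive_id (chart_map c' p) v).
apply: near_eq_derive; near=> y => /=.
have [dy yE] : dom c' (param c' y) /\ chart_map c' (param c' y) = y.
  apply: image_param; near: y; apply: open_nbhs_nbhs.
  by split; [exact: manifold_image_open hM _|exists p].
rewrite (manifold_mapK hM)//.
by near: y; apply: near_param => //; exact: manifold_dom_open hM _.
Unshelve. all: by end_near. Qed.

Lemma dchart_linear (u : T -> R) c p v : smooth_in c u -> dom c p ->
  dchart c p v u = \sum_i v 0 i * dchart c p (delta_mx 0 i) u.
Proof.
move=> su dp; have oU : open (chart_map c @` dom c).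
  exact: manifold_image_open hM _.
have [|_] := @chain_rule R _ n _ _ id (chart_map c p) v oU (su 1%N) _
  (@derivable_id _ _ _ _); first by exists p.
by rewrite derive_id.
Qed.

(** The differential of [u] with its index raised by the inverse metric; the value 0 outside the
    domain is the one imposed by [vector_field]. *)
Definition gradient (g : tensor A) (u : T -> R) : field A := fun c =>
  patch (fun=> 0) (dom c)
    (fun p => (\row_i dchart c p (delta_mx 0 i) u) *m invmx (g c p)).

Lemma gradientE (g : tensor A) (u : T -> R) c p v :
  pseudo_riemannian g -> smooth_in c u -> dom c p ->
  bform (g c p) (gradient g u c p) v = dchart c p v u.
Proof.
move=> hg su dp; rewrite /gradient patchT ?inE// /bform mulmxKV; last first.
  exact: metric_nondegenerate hg _ _ dp.
by rewrite dchart_linear// mxE; apply: eq_bigr => i _; rewrite !mxE mulrC.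
Qed.

Lemma vector_field_gradient (g : tensor A) (u : T -> R) :
  pseudo_riemannian g -> smooth_function A u -> vector_field (gradient g u).
Proof.
move=> hg su; split=> [c p ndp|c c' p dp dp'|c k].
- by rewrite /gradient patchC// inE.
(* The two sides have the same pairing with every [w]: writing [w] as the image of a vector in the
   chart [c], both pairings are the derivative of [u] along it. *)
- apply/eqP; rewrite -subr_eq0; apply/eqP.
  apply: (bform_nondegenerate (metric_nondegenerate hg dp')) => w.
  rewrite bformDl bformNl gradientE// -(dchart_transitionK w dp dp').
  by rewrite -(metric_change hg)// gradientE// -dchart_change// subrr.
- have oU : open (chart_map c @` dom c) by exact: manifold_image_open hM _.
  apply: (@Ck_ext _ _ _ _ _ (fun x =>
      (\row_i 'D_(delta_mx 0 i) (u \o param c) x) *m invmx (g c (param c x)))).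
  + by [].
  + move=> x Ux /=; have [dx xE] := image_param Ux.
    rewrite /gradient patchT ?inE//; congr (_ *m _); apply/rowP => i.
    by rewrite !mxE /dchart xE.
  + apply: Ck_mulmx => //.
      apply/Ck_mxP => // i j; apply: Ck_ext ((su c k.+1).2 (delta_mx 0 j)).2 => //.
      by move=> x _; rewrite mxE.
    apply: Ck_invmx => //; last exact: (metric_smooth hg c k).
    by move=> x /image_param[dx _]; exact: metric_nondegenerate hg _ _ dx.
Qed.

Lemma smooth_function_continuous (u : T -> R) :
  smooth_function A u -> continuous u.
Proof.
move=> su p; have [c _ dp] : (\bigcup_(c in [set: chart A]) dom c) p.
  by rewrite (manifold_cover hM).
have Up : (chart_map c @` dom c) (chart_map c p) by exists p.
apply: (@cvg_trans _ ((u \o param c \o chart_map c) @ p)).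
  apply: near_eq_cvg; near=> q => /=; rewrite (manifold_mapK hM)//.
  by near: q; apply: open_nbhs_nbhs; split=> //; exact: manifold_dom_open hM _.
have -> : u p = (u \o param c) (chart_map c p) by rewrite /= (manifold_mapK hM).
apply: (@continuous_comp _ _ _ (chart_map c) (u \o param c)).
  exact: manifold_map_continuous hM _ _ dp.
exact: (su c 0%N).1.
Unshelve. all: by end_near. Qed.

(** The level set of [u] through [q0] is closed by continuity, and open by the mean value theorem in
    a chart; connectedness makes it everything. *)
Lemma constant_of_dchart0 (u : T -> R) : connected [set: T] ->
  smooth_function A u -> (forall c p v, dom c p -> dchart c p v u = 0) ->
  forall p q, u p = u q.
Proof.
move=> cT su du p0 q0.
have cu := smooth_function_continuous su.
pose B := [set p | u p = u q0].
have oB : open B.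
  rewrite openE => p Bp; rewrite /interior.
  have [c _ dp] : (\bigcup_(c in [set: chart A]) dom c) p.
    by rewrite (manifold_cover hM).
  have /nbhs_ballP[e /= e0 beU] : nbhs (chart_map c p) (chart_map c @` dom c).
    apply: open_nbhs_nbhs; split; first exact: manifold_image_open hM _.
    by exists p.
  near=> q; have dq : dom c q.
    by near: q; apply: open_nbhs_nbhs; split=> //; exact: manifold_dom_open hM _.
  have bq : ball (chart_map c p) e (chart_map c q).
    near: q; apply: (manifold_map_continuous hM dp).
    exact: nbhsx_ballx.
  (* The whole chart image need not be convex, but the segment lies in a ball contained in it. *)
  have US (s : R) : 0 <= s <= 1 -> (chart_map c @` dom c)
      (s *: (chart_map c q - chart_map c p) + chart_map c p).
    move=> /andP[s0 s1]; apply: beU; move: bq; rewrite -!ball_normE /=.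
    rewrite opprD addrCA subrr addr0 normrN normrZ ger0_norm// distrC.
    by apply: le_lt_trans; rewrite ler_piMl.
  have [|s /US /image_param[ds sE]] := @derive_mvt _ _ (u \o param c)
      (chart_map c p) (chart_map c q - chart_map c p).
    by move=> s /US Us; apply: ((su c 1%N).2 _).1.
  rewrite subrK /= !(manifold_mapK hM)// -{1}sE.
  rewrite -/(dchart c _ _ u) du// => /eqP; rewrite subr_eq0 => /eqP.
  by rewrite /B /= => ->.
have clB : closed B.
  by apply: (@closed_comp _ _ u [set u q0]) => [x _|]; [exact: cu|exact: closed_eq].
have : B = [set: T].
  apply: cT; first by exists q0.
    by exists B => //; rewrite setTI.
  by exists B => //; rewrite setTI.
by move=> BT; have : B p0 by rewrite BT.
Unshelve. all: by end_near. Qed.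

End ManifoldCalculus.

(** * Fields on the warped spacetime *)

Section Spacetime.
Variables (R : realType) (n : nat) (T : topologicalType) (A : atlas R n T).
Hypothesis hM : is_manifold A [set: T].
Variable I : set R.
Hypothesis oI : open I.
Implicit Types (c : chart A) (t : R) (p : T) (v : 'rV[R]_n) (X Y Z : field A).

Definition time_coord (s : 'rV[R]_(1 + n)) : R := lsubmx s 0 0.

Lemma time_coord_linear : linear time_coord.
Proof. by move=> a x y; rewrite /time_coord !mxE. Qed.

Lemma time_coord_continuous : continuous time_coord.
Proof.
move=> s; apply: (@continuous_comp _ _ _ lsubmx (fun M : 'M[R]_1 => M 0 0)).
  exact: continuous_lsubmx.
exact: coord_continuous.
Qed.

Lemma rsubmx_linear : linear (rsubmx : 'rV[R]_(1 + n) -> 'rV[R]_n).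
Proof. by move=> a x y; rewrite linearP. Qed.

Lemma time_coordE t v : time_coord (row_mx t%:M v) = t.
Proof. by rewrite /time_coord row_mxKl mxE eqxx. Qed.

(** Writing the image as an intersection of preimages under the two projections gives its openness
    and fits [Ck_comp_linear]. *)
Lemma spacetime_image c :
  chart_map (c : chart (spacetime_atlas I A)) @`
    dom (c : chart (spacetime_atlas I A)) =
  (time_coord @^-1` I) `&` (rsubmx @^-1` (chart_map c @` dom c)).
Proof.
apply/seteqP; split=> [_ [[t p] [/= It dp] <-]|s [/= It [p dp pE]]].
  by split; rewrite /= ?time_coordE// row_mxKr; exists p.
exists (time_coord s, p) => //=; rewrite pE -[RHS]hsubmxK; congr row_mx.
by apply/matrixP => i j; rewrite !ord1 mxE eqxx.
Qed.

Lemma open_spacetime_image c : open ((time_coord @^-1` I) `&`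
  (rsubmx @^-1` (chart_map c @` dom c)) : set 'rV[R]_(1 + n)).
Proof.
apply: openI; apply: open_comp => //.
- by move=> s _; exact: time_coord_continuous.
- by move=> s _; exact: continuous_rsubmx.
- exact: manifold_image_open hM _.
Qed.

Lemma spacetime_fieldE (a : R -> R) X c t p :
  dom c p -> I t -> spacetime_field I a X c (t, p) = row_mx (a t)%:M (X c p).
Proof. by move=> dp It; rewrite /spacetime_field patchT// inE. Qed.

(** A function of time alone sees only the time component [b] of the direction. *)
Lemma is_derive_time (a : R -> R) t x (b : R) v : derivable a t 1 ->
  is_derive (row_mx t%:M x) (row_mx b%:M v) (a \o time_coord) (b * 'D_1 a t).
Proof.
move=> da; have := is_derive_scaledir b da; rewrite [b *: 1]mulr1 => -[d1 D1].
split; first by apply: (derivable_comp_linear time_coord_linear); rewrite !time_coordE.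
by rewrite (derive_comp_linear _ _ _ time_coord_linear) !time_coordE.
Qed.

Lemma is_derive_space (W : normedModType R) (F : 'rV[R]_n -> W) t x (b : R) v :
  derivable F x v ->
  is_derive (row_mx t%:M x) (row_mx b%:M v)
    (F \o (rsubmx : 'rV[R]_(1 + n) -> 'rV[R]_n)) ('D_v F x).
Proof.
move=> dF; split.
  by apply: (derivable_comp_linear rsubmx_linear); rewrite !row_mxKr.
by rewrite (derive_comp_linear _ _ _ rsubmx_linear) !row_mxKr.
Qed.

Lemma near_spacetime c t p : dom c p -> I t ->
  \forall s \near (row_mx t%:M (chart_map c p) : 'rV[R]_(1 + n)),
    I (time_coord s) /\ (chart_map c @` dom c) (rsubmx s).
Proof.
move=> dp It; apply: (open_nbhs_nbhs (conj (@open_spacetime_image c) _)).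
by split; rewrite /= ?time_coordE// row_mxKr; exists p.
Qed.

Section Lift.
Variables (a : R -> R) (X : field A).
Hypotheses (sa : smooth I a) (vX : vector_field X).

(** Each component is a function of time alone or of the point of [M] alone, that is, a smooth map
    composed with a projection. *)
Lemma Ck_lift c k :
  Ck k ((time_coord @^-1` I) `&` (rsubmx @^-1` (chart_map c @` dom c)))
    (spacetime_field I a X c \o @param _ _ _ (spacetime_atlas I A) c).
Proof.
have oU := open_spacetime_image (c := c).
apply: (@Ck_ext _ _ _ _ _ (fun s : 'rV[R]_(1 + n) =>
    row_mx (a (time_coord s))%:M (X c (param c (rsubmx s))))) => //.
  move=> s [/= It /(image_param hM)[ds _]].
  by rewrite spacetime_fieldE.
apply/Ck_mxP => // i j; case: (split_ordP j) => l ->.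
  apply: (@Ck_ext _ _ _ _ _ (a \o time_coord)) => // [s _|].
    by rewrite row_mxEl mxE !ord1.
  apply: (@Ck_sub _ _ _ _ (time_coord @^-1` I)); first by move=> s [].
  by apply: Ck_comp_linear (sa k); [exact: time_coord_linear|
    exact: time_coord_continuous].
apply: (@Ck_ext _ _ _ _ _ ((fun x => X c (param c x) i l) \o rsubmx)) => // [s _|].
  by rewrite row_mxEr.
apply: (@Ck_sub _ _ _ _ (rsubmx @^-1` (chart_map c @` dom c))); first by move=> s [].
apply: Ck_comp_linear; [exact: rsubmx_linear|exact: continuous_rsubmx|].
apply: (Ck_mxP _ _ _).1 (vector_field_smooth vX c k) i l.
exact: manifold_image_open hM _.
Qed.

Lemma vector_field_lift : vector_field (spacetime_field I a X).
Proof.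
split=> [c x ndx|c c' [t p] [/= It dp] [/= _ dp']|c k].
- by rewrite /spacetime_field patchC// inE.
(* A change of product charts is the identity in time and a transition map of [M] in space, so its
   differential acts on the two blocks separately. *)
- rewrite !spacetime_fieldE// (vector_field_change vX dp dp') /dchart /=.
  have /(is_derive_space t (a t)) dS := derivable_transition hM (v := X c p) dp dp'.
  have /is_derive_scalar1 dT := @is_derive_time id t (@chart_map _ _ _ A c p)
    (a t) (X c p) (@derivable_id _ _ _ _).
  have [_] := is_derive_row_mx dT dS.
  by rewrite derive_id mulr1 => <-.
- by rewrite /smooth_in spacetime_image; exact: Ck_lift.
Qed.

Lemma dchart_lift c t p (b : R) v : dom c p -> I t ->
  dchart (c : chart (spacetime_atlas I A)) (t, p) (row_mx b%:M v)
    (spacetime_field I a X c) =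
  row_mx (b * 'D_1 a t)%:M (dchart c p v (X c)).
Proof.
move=> dp It.
have /(is_derive_space t b) dS :=
  derivable_smooth_in (v := v) (vector_field_smooth vX c) dp.
have /is_derive_scalar1 dT := @is_derive_time a t (chart_map c p) b v
  (((sa 1%N).2 1).1 t It).
have [_ <-] := is_derive_row_mx dT dS.
apply: near_eq_derive; near=> s => /=.
have [Is /(image_param hM)[ds _]] : I (time_coord s) /\
  (chart_map c @` dom c) (rsubmx s) by near: s; exact: near_spacetime.
by rewrite spacetime_fieldE.
Unshelve. all: by end_near. Qed.

End Lift.

(** The mixed brackets vanish, because [a] and [b] depend on time only while [X] and [Y] do not
    depend on it. *)
Lemma lie_bracket_lift (a b : R -> R) X Y c t p :
  smooth I a -> smooth I b -> vector_field X -> vector_field Y ->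
  dom c p -> I t ->
  lie_bracket (spacetime_field I a X) (spacetime_field I b Y) c (t, p) =
  row_mx (a t * 'D_1 b t - b t * 'D_1 a t)%:M (lie_bracket X Y c p).
Proof.
move=> sa sb vX vY dp It; rewrite /lie_bracket !spacetime_fieldE//.
by rewrite !dchart_lift// opp_row_mx add_row_mx -raddfB.
Qed.

Variables (g : tensor A) (f : T -> R) (sigma : R -> R).

Lemma bform_warped c t p (a b : R) v w :
  bform (warped_metric I f sigma g c (t, p)) (row_mx a%:M v) (row_mx b%:M w) =
  - (f p ^+ 2) * (a * b) + sigma t ^+ 2 * bform (g c p) v w.
Proof.
rewrite /bform /warped_metric /= mul_row_block !mulmx0 addr0 add0r.
rewrite tr_row_mx mul_row_col mxE; congr (_ + _).
  rewrite tr_scalar_mx -!scalar_mxM mxE eqxx mulr1n.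
  by ring.
by rewrite -scalemxAr -scalemxAl mxE.
Qed.

Hypotheses (sf : smooth_function A f) (ssigma : smooth I sigma).
Hypothesis hg : pseudo_riemannian g.

Lemma derivable_bform Y Z c p v : vector_field Y -> vector_field Z -> dom c p ->
  derivable ((fun q => bform (g c q) (Y c q) (Z c q)) \o param c)
    (chart_map c p) v.
Proof.
move=> vY vZ dp; have oU : open (chart_map c @` dom c).
  exact: manifold_image_open hM _.
apply: derivable_smooth_in => // k.
have := Ck_mulmx oU
  (Ck_mulmx oU (vector_field_smooth vY c k) (metric_smooth hg c k))
  (Ck_trmx oU (vector_field_smooth vZ c k)).
by move=> /(Ck_mxP _ _ oU)/(_ 0 0).
Qed.

(** This is the product rule for [- f^2 b e + sigma^2 g(Y, Z)]: the time component [a]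
    differentiates [b], [e] and [sigma], and the space component [v] differentiates [f] and
    [g(Y, Z)]. *)
Lemma dchart_bform_lift (b e : R -> R) Y Z c t p (a : R) v :
  smooth I b -> smooth I e -> vector_field Y -> vector_field Z ->
  dom c p -> I t ->
  dchart (c : chart (spacetime_atlas I A)) (t, p) (row_mx a%:M v)
    (fun x => bform (warped_metric I f sigma g c x)
      (spacetime_field I b Y c x) (spacetime_field I e Z c x)) =
  - (2 * f p * dchart c p v f) * (b t * e t)
  - f p ^+ 2 * (a * ('D_1 b t * e t + b t * 'D_1 e t))
  + 2 * sigma t * (a * 'D_1 sigma t) * bform (g c p) (Y c p) (Z c p)
  + sigma t ^+ 2 * dchart c p v (fun q => bform (g c q) (Y c q) (Z c q)).
Proof.
move=> sb se vY vZ dp It.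
have dtime (u : R -> R) : smooth I u -> is_derive (row_mx t%:M (chart_map c p))
    (row_mx a%:M v) (u \o time_coord) (a * 'D_1 u t).
  by move=> su; apply: is_derive_time; exact: ((su 1%N).2 1).1.
have db := dtime b sb; have de := dtime e se; have ds := dtime sigma ssigma.
have /(is_derive_space t a) df := derivable_smooth_in (v := v) (sf c) dp.
have /(is_derive_space t a) dg := derivable_bform (v := v) vY vZ dp.
have dmix := is_deriveD
  (is_deriveN (is_deriveM (is_deriveM df df) (is_deriveM db de)))
  (is_deriveM (is_deriveM ds ds) dg).
transitivity ('D_(row_mx a%:M v)
  (- (((f \o param c) \o rsubmx) * ((f \o param c) \o rsubmx) *
     ((b \o time_coord) * (e \o time_coord))) +
   (sigma \o time_coord) * (sigma \o time_coord) *
   (((fun q => bform (g c q) (Y c q) (Z c q)) \o param c) \o rsubmx))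
   (row_mx t%:M (chart_map c p))).
  (* The lifted fields are 0 outside the product domain, so the explicit expression holds only near
     the point. *)
  apply: near_eq_derive; near=> s => /=.
  have [Is /(image_param hM)[dps _]] : I (time_coord s) /\
    (chart_map c @` dom c) (rsubmx s) by near: s; exact: near_spacetime.
  rewrite !spacetime_fieldE// bform_warped /= expr2.
  by rewrite -/(time_coord s) mulNr.
have [_ ->] := dmix.
rewrite /= !fctE /= /dchart time_coordE row_mxKr (manifold_mapK hM)//.
by rewrite /GRing.scale /=; ring.
Unshelve. all: by end_near. Qed.

End Spacetime.

(** * The Koszul formula for the warped metric *)

Section WarpedKoszul.
Variables (R : realType) (n : nat) (T : topologicalType) (A : atlas R n T).
Variables (g : tensor A) (I : set R) (f : T -> R) (sigma h : R -> R).
Variables (zeta : field A) (D : field A -> field A -> field A).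
Variable Dbar : field (spacetime_atlas I A) -> field (spacetime_atlas I A) ->
  field (spacetime_atlas I A).
Hypotheses (hM : is_manifold A [set: T]) (hg : pseudo_riemannian g).
Hypotheses (oI : open I) (sf : smooth_function A f).
Hypotheses (ssigma : smooth I sigma) (sh : smooth I h).
Hypothesis vzeta : vector_field zeta.
Hypotheses (hD : levi_civita g D).
Hypothesis hDbar : levi_civita (warped_metric I f sigma g) Dbar.
Hypothesis hconc : concurrent Dbar (spacetime_field I h zeta).

(* The Koszul formula for the covariant derivative of [h d/dt + zeta] along
   [a d/dt + X], paired with [b d/dt + Y]. *)
Lemma koszul_warped (a b : R -> R) (X Y : field A) (c : chart A) t p :
  smooth I a -> smooth I b -> vector_field X -> vector_field Y ->
  dom c p -> I t ->
  - f p ^+ 2 * a t * b t + sigma t ^+ 2 * bform (g c p) (X c p) (Y c p) =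
  sigma t ^+ 2 * bform (g c p) (D X zeta c p) (Y c p)
  - f p * h t * (b t * dchart c p (X c p) f - a t * dchart c p (Y c p) f)
  - f p * dchart c p (zeta c p) f * a t * b t
  - f p ^+ 2 * a t * b t * 'D_1 h t
  + sigma t * 'D_1 sigma t *
    (a t * bform (g c p) (zeta c p) (Y c p)
     + h t * bform (g c p) (X c p) (Y c p)
     - b t * bform (g c p) (X c p) (zeta c p)).
Proof.
move=> sa sb vX vY dp It.
have vXb := vector_field_lift hM oI sa vX.
have vYb := vector_field_lift hM oI sb vY.
have vZb := vector_field_lift hM oI sh vzeta.
have sG c' p' : dom c' p' -> (g c' p')^T = g c' p'.
  by exact: Defs.metric_sym hg _ _.
have sW (c' : chart (spacetime_atlas I A)) x : dom c' x ->
    (warped_metric I f sigma g c' x)^T = warped_metric I f sigma g c' x.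
  case: x => s q [/= _ dq]; rewrite /warped_metric tr_block_mx !trmx0.
  by rewrite tr_scalar_mx [(_ *: _)^T]linearZ /= sG.
have K := koszul sG hD vX vzeta vY dp.
have dtp : dom (c : chart (spacetime_atlas I A)) (t, p) by [].
have := koszul sW hDbar vXb vZb vYb dtp.
rewrite (hconc.2 _ vXb).
rewrite !(lie_bracket_lift hM oI)// !spacetime_fieldE// !bform_warped.
rewrite !(dchart_bform_lift hM)//.
(* Derivatives, brackets and pairings become real variables, which leaves polynomial identities. *)
move: K; move: (dchart c p (X c p) (fun _ => _))
  (dchart c p (zeta c p) (fun _ => _)) (dchart c p (Y c p) (fun _ => _)).
move: (bform _ (lie_bracket X zeta c p) _) (bform _ _ (lie_bracket X Y c p))
  (bform _ _ (lie_bracket zeta Y c p)) (bform _ (D X zeta c p) _).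
move: (bform _ (X c p) (Y c p)) (bform _ (zeta c p) (Y c p))
  (bform _ (X c p) (zeta c p)) (dchart c p (X c p) f) (dchart c p (Y c p) f).
move: (dchart c p (zeta c p) f) (a t) (b t) (h t) (sigma t) (f p).
move: ('D_1 a t) ('D_1 b t) ('D_1 h t) ('D_1 sigma t).
move=> a' b' h' s' zf a0 b0 h0 s f0 XY ZY XZ Xf Yf l1 l2 l3 N d1 d2 d3 K E.
(* The Koszul formula on [M] is solved for the derivative of [g(zeta, Y)] along [X]; substituting it
   eliminates the other derivatives of pairings and the brackets. *)
have {K} d1E : d1 = 2 * N - d2 + d3 - l1 + l2 + l3 by rewrite K; ring.
apply: (mulfI (_ : 2 != 0 :> R)); first by rewrite pnatr_eq0.
transitivity (2 * (- f0 ^+ 2 * (a0 * b0) + s ^+ 2 * XY)); first by ring.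
by rewrite E d1E; ring.
Qed.

End WarpedKoszul.

(** * Zero fields, constancy on an interval, and the theorem *)

Lemma vector_field0 (R : realType) (n : nat) (T : Type) (A : atlas R n T) :
  vector_field ((fun _ _ => 0) : field A).
Proof.
by split=> [//|c c' p _ _|c k]; [rewrite /dchart derive0|exact: Ck_cst].
Qed.

Lemma riemannian_eq0 (R : realType) (n : nat) (T : Type) (A : atlas R n T)
    (g : tensor A) c p v :
  riemannian g -> dom c p -> bform (g c p) v v = 0 -> v = 0.
Proof.
move=> hg dp; case: (eqVneq v 0) => // v0 gv.
by have := hg.2 c p v dp v0; rewrite gv ltxx.
Qed.

(** The mean value theorem is applied on the segment from [s] to [t], which stays in the interval
    [I]; by symmetry [s <= t] may be assumed. *)
Lemma constant_of_derive0 (R : realType) (I : set R) (u : R -> R) :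
  is_interval I -> smooth I u -> (forall t, I t -> 'D_1 u t = 0) ->
  forall s t, I s -> I t -> u s = u t.
Proof.
move=> iI su u0.
suff H s t : I s -> I t -> s <= t -> u s = u t.
  by move=> s t Is It; case: (leP s t) => [|/ltW] st; [|apply/esym]; exact: H.
move=> Is It st; have Ir (r : R) : 0 <= r <= 1 -> I (r *: (t - s) + s).
  move=> /andP[r0 r1]; apply: (iI s t) => //.
  rewrite lerDr mulr_ge0 ?subr_ge0//= -lerBrDr.
  by rewrite ler_piMl ?subr_ge0.
have der r : I r -> is_derive r (t - s) u ((t - s) *: 'D_1 u r).
  move=> Ir'; rewrite -[X in is_derive _ X](mulr1 (t - s)).
  by apply: is_derive_scaledir; exact: ((su 1%N).2 1).1.
have [r /Ir/der[//]|r /Ir Irs] := @derive_mvt R R^o u s (t - s).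
have [_ ->] := der _ Irs; rewrite u0// scaler0 subrK => /eqP.
by rewrite subr_eq0 => /eqP.
Qed.

(** Additivity applied to [0 + 0 = 0]. It handles derivatives along d/dt, whose space part is the
    zero field. *)
Lemma connection0l (R : realType) (n : nat) (T : Type) (A : atlas R n T)
    (k : tensor A) (D : field A -> field A -> field A) (Z : field A) c p :
  levi_civita k D -> vector_field Z -> D (fun _ _ => 0) Z c p = 0.
Proof.
move=> hD vZ; have v0 := vector_field0 A.
have : field_add (fun _ _ => 0) (fun _ _ => 0) = (fun _ _ => 0) :> field A.
  by apply/funext => c'; apply/funext => q; rewrite /field_add addr0.
have := connection_addl hD v0 v0 vZ; move=> + E; rewrite E.
move=> /(congr1 (fun F => F c p)); rewrite /field_add => /eqP.
by rewrite -subr_eq0 opprD addNKr oppr_eq0 => /eqP.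
Qed.

Theorem theorem11 (R : realType) (n : nat)
    (M : topologicalType) (A : atlas R n M) (hM : is_manifold A [set: M])
    (hM0 : [set: M] !=set0) (hMc : connected [set: M])
    (g : tensor A) (hg : riemannian g)
    (I : set R) (hIo : open I) (hIi : is_interval I) (hI0 : I !=set0)
    (f : M -> R) (hf : smooth_function A f) (hf0 : forall p, 0 < f p)
    (sigma : R -> R) (hsigma : smooth I sigma)
    (hsigma0 : forall t, I t -> 0 < sigma t)
    (h : R -> R) (hh : smooth I h)
    (zeta : field A) (hzeta : vector_field zeta)
    (D : field A -> field A -> field A) (hD : levi_civita g D)
    (Dbar : field (spacetime_atlas I A) -> field (spacetime_atlas I A) ->
            field (spacetime_atlas I A))
    (hDbar : levi_civita (warped_metric I f sigma g) Dbar)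
    (hconc : concurrent Dbar (spacetime_field I h zeta)) :
  let h_zero := forall t, I t -> h t = 0 in
  let sigma_constant := exists a, forall t, I t -> sigma t = a in
  let f_constant := exists b, forall p, f p = b in
  (h_zero \/ sigma_constant -> concurrent D zeta) /\
  (h_zero -> sigma_constant) /\
  (~ f_constant -> sigma_constant -> h_zero).
Proof.
move=> h_zero sigma_constant f_constant.
have hg' := hg.1; have v0 := vector_field0 A.
(* Equality with [a] is known on [I] only; openness of [I] turns it into equality near [t]. *)
have D_cst (u : R -> R) a t : I t -> (forall s, I s -> u s = a) -> 'D_1 u t = 0.
  move=> It ua; rewrite -(derive_cst a t 1); apply: near_eq_derive.
  by apply: filterS ua _; exact: open_nbhs_nbhs.
have s1 : smooth I (cst 1 : R -> R) by move=> k; exact: Ck_cst.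
have s0 : smooth I (cst 0 : R -> R) by move=> k; exact: Ck_cst.
have K := koszul_warped hM hg' hIo hf hsigma hh hzeta hD hDbar hconc.
(* The case [a = 1], [b = 0], [X = 0]. *)
have time_space Y c p t : vector_field Y -> dom c p -> I t ->
    sigma t * 'D_1 sigma t * bform (g c p) (zeta c p) (Y c p) =
    - (f p * h t * dchart c p (Y c p) f).
  move=> vY dp It; have := K _ _ _ _ c t p s1 s0 v0 vY dp It.
  rewrite (connection0l _ _ hD hzeta) !bform0l [dchart c p 0 f]derive0 /= => E.
  apply/eqP; rewrite -addr_eq0 addrC; apply/eqP; move: E.
  rewrite !(mulr0, mul0r, subr0, addr0, add0r, sub0r, mul1r, mulr1).
  by rewrite mulrN opprK => <-.
(* The case [a = b = 1], [X = Y = 0], divided by [- f p]. *)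
have time_time c p t : dom c p -> I t ->
    f p = dchart c p (zeta c p) f + f p * 'D_1 h t.
  move=> dp It; have := K _ _ _ _ c t p s1 s1 v0 v0 dp It.
  rewrite (connection0l _ _ hD hzeta) !bform0l bform0r.
  rewrite [dchart c p 0 f]derive0 /= => E.
  apply: (mulfI (lt0r_neq0 (hf0 p))); apply: oppr_inj.
  move: E; rewrite !mulr0 !addr0 !subr0 add0r !mulr1 => E.
  by rewrite -expr2 E; ring.
(* The case [a = b = 0]: the hypothesis on [h] and [sigma] removes the last term, and [sigma t ^+ 2]
   cancels. *)
have space_space X Y c p t : vector_field X -> vector_field Y ->
    dom c p -> I t -> h t * 'D_1 sigma t = 0 ->
    bform (g c p) (D X zeta c p) (Y c p) = bform (g c p) (X c p) (Y c p).
  move=> vX vY dp It hs; have := K _ _ _ _ c t p s0 s0 vX vY dp It.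
  have hs' : sigma t * 'D_1 sigma t * (h t * bform (g c p) (X c p) (Y c p)) = 0.
    by rewrite mulrA -(mulrA (sigma t)) (mulrC ('D_1 sigma t)) hs mulr0 mul0r.
  rewrite /= !(mulr0, mul0r, subr0, oppr0, addr0, add0r) hs' addr0 => /esym.
  by apply: mulfI; rewrite expf_neq0// lt0r_neq0// hsigma0.
split; [|split].
- move=> hyp; split=> // X vX.
  have vDX := connection_field hD vX hzeta.
  apply/funext => c; apply/funext => p.
  have [dp|ndp] := pselect (dom c p); last first.
    by rewrite (vector_field_out vX)// (vector_field_out vDX).
  have [t It] := hI0.
  (* Either condition makes one of the two factors vanish, and a single time [t] suffices. *)
  have hs : h t * 'D_1 sigma t = 0.
    by case: hyp => [->//|[a /(D_cst _ _ _ It) ->]]; rewrite ?mul0r ?mulr0.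
  (* The difference [D X zeta - X] is paired with itself; [space_space] is used with [Y] equal to
     [D X zeta] and to [X], both global fields. *)
  apply/eqP; rewrite -subr_eq0; apply/eqP; apply: (riemannian_eq0 hg dp).
  rewrite bformDl bformNl !bformDr !bformNr.
  by rewrite !(space_space _ _ _ _ _ vX _ dp It hs)// !subrr.
- move=> hz; have [t0 It0] := hI0; exists (sigma t0) => t It.
  apply: (constant_of_derive0 hIi hsigma) => // {It} {}t It; apply: contrapT => ds.
  have [p _] := hM0; have [c _ dp] : (\bigcup_(c in [set: chart A]) dom c) p.
    by rewrite (manifold_cover hM).
  (* For [h = 0] and [Y = zeta], [time_space] reads [sigma sigma' g(zeta, zeta) = 0], with [sigma]
     and [sigma'] nonzero at [t]. *)
  have z0 : zeta c p = 0.
    apply: (riemannian_eq0 hg dp); have := time_space _ c p t hzeta dp It.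
    rewrite hz// mulr0 mul0r oppr0 => /eqP; rewrite !mulf_eq0.
    by rewrite (gt_eqF (hsigma0 _ It)) (negbTE (introN eqP ds)) => /eqP.
  (* Both terms on the right vanish, as [zeta] is 0 at [p] and [h] is constant on [I]; this
     contradicts [0 < f p]. *)
  have := time_time c p t dp It.
  rewrite z0 /dchart derive0 add0r (D_cst _ _ _ It hz) mulr0 => f0.
  by have := hf0 p; rewrite f0 ltxx.
- move=> nf [a sa] t It; apply: contrapT => ht; apply: nf.
  have [p0 _] := hM0; exists (f p0) => p.
  apply: (constant_of_dchart0 hM hMc hf) => c q v dq.
  have vG := vector_field_gradient hM hg' hf.
  rewrite -(gradientE hM v hg' (hf c) dq).
  (* The squared length of the gradient is the derivative of [f] along it, which [time_space] forces
     to vanish because [f q] and [h t] are nonzero. *)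
  have -> : gradient g f c q = 0; last by rewrite bform0l.
  apply: (riemannian_eq0 hg dq); rewrite (gradientE hM)//.
  have := time_space _ c q t vG dq It.
  rewrite (D_cst _ _ _ It sa) mulr0 mul0r => /esym/eqP.
  rewrite oppr_eq0 !mulf_eq0 (gt_eqF (hf0 q)) (negbTE (introN eqP ht)).
  by move=> /eqP.
Qed.
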